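(* Let $\Lambda_n^{MP}$ denote the Lebesgue constant of polynomial interpolation in $\mathbb{P}^2_n$ at the Morrow-Patterson points $MP_n$ on $Q=[-1,1]^2$. Then $\Lambda_n^{MP}=\mathcal O(n^2)$, i.e. there is a constant $C>0$ such that $\Lambda_n^{MP}\le Cn^2$ for all positive even integers $n$.
   Context: $\mathbb{P}^2_n$ is the space of real bivariate polynomials of total degree at most $n$. For a positive even integer $n$, the Morrow-Patterson points are $MP_n=\{(x_m,y_{m,k}) : m=1,\dots,n+1,\ k=1,\dots,\tfrac n2+1\}$ with $x_m=\cos\frac{m\pi}{n+2}$ and $y_{m,k}=\cos\frac{2k\pi}{n+3}$ if $m$ is odd, $y_{m,k}=\cos\frac{(2k-1)\pi}{n+3}$ if $m$ is even; this set has $\binom{n+2}{2}$ points and is unisolvent for $\mathbb{P}^2_n$. The Lebesgue constant is $\Lambda_n^{MP}=\max_{(x,y)\in Q}\sum_{a\in MP_n}|\ell_a(x,y)|$, where $\ell_a\in\mathbb{P}^2_n$ are the Lagrange basis polynomials ($\ell_a(b)=\delta_{ab}$ for $a,b\in MP_n$); equivalently it is the operator norm (in the sup-norm on $Q$) of the interpolation operator $\mathcal C(Q)\to\mathbb{P}^2_n$ at $MP_n$. *)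

(* Defs.v *)
From Stdlib Require Import Reals Lra Lia Arith.
Open Scope R_scope.

Definition mp_x (n m : nat) : R := cos (INR m * PI / INR (n + 2)).

Definition mp_y (n m k : nat) : R :=
  if Nat.odd m then cos (2 * INR k * PI / INR (n + 3))
  else cos ((2 * INR k - 1) * PI / INR (n + 3)).

Definition in_P2 (n : nat) (p : R -> R -> R) : Prop :=
  exists c : nat -> nat -> R, forall x y : R,
    p x y = sum_f_R0 (fun i => sum_f_R0 (fun j => c i j * x ^ i * y ^ j) (n - i)) n.

Definition mp_index (n m k : nat) : Prop :=
  (1 <= m <= n + 1)%nat /\ (1 <= k <= Nat.div n 2 + 1)%nat.

Definition is_MP_lagrange_basis (n : nat) (l : nat -> nat -> R -> R -> R) : Prop :=
  (forall m k, mp_index n m k -> in_P2 n (l m k)) /\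
  (forall m k m' k', mp_index n m k -> mp_index n m' k' ->
     l m k (mp_x n m') (mp_y n m' k') =
       if (Nat.eqb m m' && Nat.eqb k k')%bool then 1 else 0).

Definition MP_lebesgue_function (n : nat) (l : nat -> nat -> R -> R -> R)
  (x y : R) : R :=
  sum_f_R0 (fun i =>
    sum_f_R0 (fun j => Rabs (l (S i) (S j) x y)) (Nat.div n 2)) n.

(* Main.v *)
Require Import Defs.
From Stdlib Require Import Reals Lra Lia Arith.
Open Scope R_scope.

(** With N = n + 2, the Morrow-Patterson points are half of the product grid
    (cos a, cos b), a = m pi / N, b = l pi / (N + 1), and discrete orthogonality of sines
    there gives the Lagrange polynomials in closed form,
    8 / (N (N + 1)) sin a sin b S  with
    S = sum over p + q <= N of U_(p-1)(x) U_(q-1)(y) sin (p a) sin (q b).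
    So it suffices to bound the sum of |sin a sin b S| over the full grid by O(N^4), and by
    symmetry of that grid only for x, y in [0, 1]. Plain Cauchy-Schwarz loses a factor N at
    the corners, where S concentrates along cos a - x = cos b - y; hence the weight
    rho = N (X - Y)^2 + N (A + B) X^2 + N^2 A B, where X = cos a - x, Y = cos b - y,
    A = 1 - x + 1/N^2, B = 1 - y + 1/N^2. By Christoffel-Darboux, X S and (X - Y) S
    collapse to single sums in q, so Parseval gives that the sum of rho S^2 is O(N^6). On the
    other side, for fixed a, sin^2 a sin^2 b / rho is O(N / (1 + (l - c)^2)) for some real c,
    so its sum over the grid is O(N^2). *)

(** * Finite sums over 1, ..., n *)

Fixpoint sum1 (f : nat -> R) (n : nat) : R :=
  match n with
  | O => 0
  | S k => sum1 f k + f (S k)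
  end.

Lemma sum1_ext f g n :
  (forall i, (1 <= i <= n)%nat -> f i = g i) -> sum1 f n = sum1 g n.
Proof.
  induction n as [|n IH]; intros H; simpl; [reflexivity|].
  rewrite IH, (H (S n)); [reflexivity | lia | intros; apply H; lia].
Qed.

Lemma sum1_le f g n :
  (forall i, (1 <= i <= n)%nat -> f i <= g i) -> sum1 f n <= sum1 g n.
Proof.
  induction n as [|n IH]; intros H; simpl; [lra|].
  apply Rplus_le_compat; [apply IH; intros |]; apply H; lia.
Qed.

Lemma sum1_plus f g n : sum1 (fun i => f i + g i) n = sum1 f n + sum1 g n.
Proof. induction n as [|n IH]; simpl; [|rewrite IH]; ring. Qed.

Lemma sum1_scal c f n : sum1 (fun i => c * f i) n = c * sum1 f n.
Proof. induction n as [|n IH]; simpl; [|rewrite IH]; ring. Qed.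

Lemma sum1_zero n : sum1 (fun _ => 0) n = 0.
Proof. induction n as [|n IH]; simpl; [|rewrite IH]; ring. Qed.

Lemma sum1_const c n : sum1 (fun _ => c) n = INR n * c.
Proof. induction n as [|n IH]; [simpl|cbn [sum1]; rewrite IH, S_INR]; ring. Qed.

Lemma sum1_le_const c f n :
  (forall i, (1 <= i <= n)%nat -> f i <= c) -> sum1 f n <= INR n * c.
Proof. intros H; rewrite <- sum1_const; apply sum1_le; exact H. Qed.

Lemma sum1_ge0 f n :
  (forall i, (1 <= i <= n)%nat -> 0 <= f i) -> 0 <= sum1 f n.
Proof. intros H; rewrite <- (sum1_zero n); apply sum1_le; exact H. Qed.

Lemma sum1_swap (f : nat -> nat -> R) m n :
  sum1 (fun i => sum1 (fun j => f i j) n) m = sum1 (fun j => sum1 (fun i => f i j) m) n.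
Proof.
  induction m as [|m IH]; simpl; [symmetry; apply sum1_zero|].
  rewrite IH, <- sum1_plus; reflexivity.
Qed.

Lemma sum1_first f n : sum1 f (S n) = f 1%nat + sum1 (fun i => f (S i)) n.
Proof.
  induction n as [|n IH]; [simpl; ring|].
  change (sum1 f (S (S n))) with (sum1 f (S n) + f (S (S n))).
  rewrite IH; simpl; ring.
Qed.

Lemma sum1_rev f n : sum1 f n = sum1 (fun i => f (n + 1 - i)%nat) n.
Proof.
  induction n as [|n IH]; [reflexivity|].
  rewrite (sum1_first (fun i => f (S n + 1 - i)%nat)).
  change (sum1 f (S n)) with (sum1 f n + f (S n)).
  rewrite IH, Rplus_comm. replace (S n + 1 - 1)%nat with (S n) by lia.
  apply Rplus_eq_compat_l, sum1_ext; intros i Hi; f_equal; lia.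
Qed.

Lemma sum1_delta j f n :
  sum1 (fun i => if Nat.eqb i j then f i else 0) n =
  if andb (Nat.leb 1 j) (Nat.leb j n) then f j else 0.
Proof.
  induction n as [|n IH]; cbn [sum1].
  - destruct j; reflexivity.
  - rewrite IH; destruct (Nat.eqb_spec (S n) j) as [<-|H];
      repeat match goal with |- context [Nat.leb ?a ?b] => destruct (Nat.leb_spec a b) end;
      cbn [andb]; try lia; ring.
Qed.

(** Both sides run over the triangle p + q <= N. Padding the inner range to N with an indicator
    turns the triangle into a square, where [sum1_swap] applies. *)
Lemma sum1_triangle_swap (f : nat -> nat -> R) N :
  sum1 (fun q => sum1 (fun p => f p q) (N - q)) N =
  sum1 (fun p => sum1 (fun q => f p q) (N - p)) N.
Proof.
  assert (E : forall (g : nat -> R) q, (q <= N)%nat -> sum1 g (N - q) =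
            sum1 (fun p => if Nat.leb (p + q) N then g p else 0) N).
  { intros g q Hq.
    assert (G : forall k, sum1 (fun p => if Nat.leb (p + q) N then g p else 0) (N - q + k)
             = sum1 g (N - q)).
    { induction k as [|k IH].
      - rewrite Nat.add_0_r; apply sum1_ext; intros i Hi.
        destruct (Nat.leb_spec (i + q) N); [reflexivity | lia].
      - rewrite Nat.add_succ_r; cbn [sum1]; rewrite IH.
        rewrite (proj2 (Nat.leb_gt _ _)) by lia; ring. }
    rewrite <- (G q); f_equal; lia. }
  rewrite (sum1_ext _ (fun q => sum1 (fun p => if Nat.leb (p + q) N then f p q else 0) N)).
  2: { intros q Hq; apply E; lia. }
  rewrite sum1_swap; apply sum1_ext; intros p Hp.
  rewrite E by lia; apply sum1_ext; intros q Hq; now rewrite Nat.add_comm.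
Qed.

Lemma sum_f_R0_sum1 f n : sum_f_R0 (fun i => f (S i)) n = sum1 f (S n).
Proof. induction n as [|n IH]; [simpl; ring|]. simpl in *. rewrite IH; reflexivity. Qed.

(** * Chebyshev polynomials of the second kind *)

(* [chebU x p] is U_(p-1)(x); the shift gives [chebU x 0 = 0]. *)
Fixpoint chebU (x : R) (p : nat) : R :=
  match p with
  | O => 0
  | S p' => match p' with O => 1 | S p'' => 2 * x * chebU x p' - chebU x p'' end
  end.

Lemma chebU_rec x p : chebU x (S (S p)) = 2 * x * chebU x (S p) - chebU x p.
Proof. reflexivity. Qed.

Lemma neg1_sqr k : (-1) ^ k * (-1) ^ k = 1.
Proof.
  rewrite <- Rpow_mult_distr; replace (-1 * -1) with 1 by ring; apply pow1.
Qed.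

Lemma chebU_opp x p : chebU (- x) p = (-1) ^ S p * chebU x p.
Proof.
  enough (H : chebU (- x) p = (-1) ^ S p * chebU x p /\
              chebU (- x) (S p) = (-1) ^ p * chebU x (S p)) by apply H.
  induction p as [|p [I1 I2]]; [simpl; lra|].
  rewrite !chebU_rec, I1, I2; simpl; split; ring.
Qed.

Lemma sin_mul_rec a p :
  sin (INR (S (S p)) * a) = 2 * cos a * sin (INR (S p) * a) - sin (INR p * a).
Proof.
  replace (INR (S (S p)) * a) with (INR (S p) * a + a) by (rewrite !S_INR; ring).
  replace (INR p * a) with (INR (S p) * a - a) by (rewrite !S_INR; ring).
  rewrite sin_plus, sin_minus; ring.
Qed.

Lemma chebU_cos a p : chebU (cos a) p * sin a = sin (INR p * a).
Proof.
  assert (H : chebU (cos a) p * sin a = sin (INR p * a) /\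
              chebU (cos a) (S p) * sin a = sin (INR (S p) * a)).
  { induction p as [|p [I1 I2]].
    - simpl; rewrite !Rmult_0_l, sin_0, !Rmult_1_l; split; ring.
    - split; [exact I2|]. rewrite sin_mul_rec, <- I1, <- I2, chebU_rec; ring. }
  apply H.
Qed.

(** The recurrence conserves this quadratic form. It takes the place of sin^2 + cos^2 = 1, so the
    bounds below need no substitution x = cos t. *)
Lemma chebU_invariant x p :
  chebU x (S p) ^ 2 - 2 * x * chebU x (S p) * chebU x p + chebU x p ^ 2 = 1.
Proof.
  induction p as [|p IH]; [simpl; ring|]. rewrite <- IH, chebU_rec; ring.
Qed.

Lemma chebU_diff_bound x p : 0 <= x <= 1 -> Rabs (chebU x (S p) - chebU x p) <= 2.
Proof.
  intros Hx. pose proof (chebU_invariant x p) as H.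
  apply Rabs_le. set (a := chebU x (S p)) in *. set (b := chebU x p) in *.
  (* The invariant is diagonal in a - b and a + b. As x >= 0, the first coefficient is at least 1,
     hence (a - b)^2 <= 2. *)
  assert (H2 : (a - b) ^ 2 * (1 + x) + (a + b) ^ 2 * (1 - x) = 2) by nra.
  assert (0 <= (a + b) ^ 2 * (1 - x)) by (apply Rmult_le_pos; [apply pow2_ge_0|lra]).
  assert (0 <= (a - b) ^ 2 * x) by (apply Rmult_le_pos; [apply pow2_ge_0|lra]).
  nra.
Qed.

Lemma chebU_bound x p : 0 <= x <= 1 -> Rabs (chebU x p) <= 2 * INR p.
Proof.
  intros Hx; induction p as [|p IH]; [simpl; rewrite Rabs_R0; lra|].
  replace (chebU x (S p)) with (chebU x p + (chebU x (S p) - chebU x p)) by ring.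
  eapply Rle_trans; [apply Rabs_triang|].
  pose proof (chebU_diff_bound x p Hx). rewrite S_INR; lra.
Qed.

(** Completing the square in the invariant gives b^2 (1 - x^2) <= 1, and 1 - x <= 1 - x^2 on
    [0, 1]. *)
Lemma chebU_sqr_bound x p : 0 <= x <= 1 -> chebU x p ^ 2 * (1 - x) <= 1.
Proof.
  intros Hx. pose proof (chebU_invariant x p) as H.
  set (a := chebU x (S p)) in *. set (b := chebU x p) in *.
  assert (0 <= (a - x * b) ^ 2) by apply pow2_ge_0.
  assert (0 <= b ^ 2 * ((1 - x) * x)) by (apply Rmult_le_pos; [apply pow2_ge_0|nra]).
  nra.
Qed.

Lemma chebU_weight_bound x p N : 0 <= x <= 1 -> (p <= N)%nat -> (0 < N)%nat ->
  chebU x p ^ 2 * (1 - x + / INR N ^ 2) <= 5.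
Proof.
  intros Hx Hp HN. pose proof (chebU_sqr_bound x p Hx).
  assert (HN' : 0 < INR N) by (apply lt_0_INR; lia).
  assert (Hb : chebU x p ^ 2 <= (2 * INR N) ^ 2).
  { apply pow_maj_Rabs. eapply Rle_trans; [apply chebU_bound; exact Hx|].
    apply le_INR in Hp; lra. }
  assert (chebU x p ^ 2 * / INR N ^ 2 <= 4).
  { apply Rmult_le_reg_r with (INR N ^ 2); [nra|].
    rewrite Rmult_assoc, Rinv_l by nra. nra. }
  lra.
Qed.

(** * Discrete orthogonality of sines *)

Definition node (N m : nat) : R := INR m * PI / INR N.

Lemma cos_sin_INR_PI m : cos (INR m * PI) = (-1) ^ m /\ sin (INR m * PI) = 0.
Proof.
  induction m as [|m [I1 I2]]; [simpl; rewrite Rmult_0_l, cos_0, sin_0; auto|].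
  replace (INR (S m) * PI) with (INR m * PI + PI) by (rewrite S_INR; ring).
  rewrite neg_cos, neg_sin, I1, I2; simpl; split; ring.
Qed.

(** The Dirichlet kernel: multiplied by 2 sin (t / 2), the sum telescopes. *)
Lemma cos_sum t n :
  2 * sin (t / 2) * sum1 (fun m => cos (INR m * t)) n = sin (INR n * t + t / 2) - sin (t / 2).
Proof.
  induction n as [|n IH]; [simpl; rewrite Rmult_0_l, Rplus_0_l; ring|].
  cbn [sum1]; rewrite Rmult_plus_distr_l, IH.
  replace (INR n * t + t / 2) with (INR (S n) * t - t / 2) by (rewrite S_INR; field).
  rewrite sin_minus, sin_plus; ring.
Qed.

Lemma cos_node_sum M j : (0 < j < 2 * S M)%nat ->
  sum1 (fun m => cos (INR j * node (S M) m)) M = - (1 + (-1) ^ j) / 2.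
Proof.
  intros Hj. assert (HN : 0 < INR (S M)) by (apply lt_0_INR; lia).
  set (t := INR j * PI / INR (S M)).
  rewrite (sum1_ext _ (fun m => cos (INR m * t))).
  2: { intros m _; f_equal; unfold t, node; field; lra. }
  (* The range of [j] puts t / 2 strictly between 0 and PI, so the factor in [cos_sum] can be
     cancelled. *)
  assert (Hs : 0 < sin (t / 2)).
  { assert (0 < INR j) by (apply lt_0_INR; lia).
    assert (INR j < 2 * INR (S M)).
    { change 2 with (INR 2); rewrite <- mult_INR; apply lt_INR; lia. }
    pose proof PI_RGT_0.
    apply sin_gt_0; unfold t; apply Rmult_lt_reg_r with (2 * INR (S M)); try lra.
    - rewrite Rmult_0_l; field_simplify; [nra|lra].
    - field_simplify; [nra|lra]. }
  apply Rmult_eq_reg_l with (2 * sin (t / 2)); [|lra].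
  rewrite cos_sum.
  replace (INR M * t + t / 2) with (INR j * PI - t / 2)
    by (unfold t; rewrite S_INR in *; field; lra).
  destruct (cos_sin_INR_PI j) as [E1 E2]; rewrite sin_minus, E1, E2; field.
Qed.

Lemma sin_node_orthogonal M p q : (1 <= p <= M)%nat -> (1 <= q <= M)%nat ->
  sum1 (fun m => sin (INR p * node (S M) m) * sin (INR q * node (S M) m)) M =
  if Nat.eqb p q then INR (S M) / 2 else 0.
Proof.
  assert (L : forall p q, (1 <= q <= p)%nat -> (p <= M)%nat ->
    sum1 (fun m => sin (INR p * node (S M) m) * sin (INR q * node (S M) m)) M =
    if Nat.eqb p q then INR (S M) / 2 else 0).
  { clear p q; intros p q Hq Hp.
    rewrite (sum1_ext _ (fun m => / 2 * cos (INR (p - q) * node (S M) m)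
                                + (- / 2) * cos (INR (p + q) * node (S M) m))).
    2: { intros m _; rewrite plus_INR, minus_INR by lia.
         rewrite Rmult_minus_distr_r, Rmult_plus_distr_r, cos_minus, cos_plus; field. }
    rewrite sum1_plus, !sum1_scal, (cos_node_sum M (p + q)) by lia.
    destruct (Nat.eqb_spec p q) as [->|H].
    - rewrite (sum1_ext _ (fun _ => 1)).
      2: { intros m _; rewrite Nat.sub_diag; simpl; rewrite Rmult_0_l; apply cos_0. }
      rewrite sum1_const, pow_add, neg1_sqr, S_INR; field.
    - rewrite cos_node_sum by lia.
      replace (p + q)%nat with (p - q + (q + q))%nat by lia.
      rewrite (pow_add _ (p - q)), (pow_add _ q), neg1_sqr; field. }
  intros Hp Hq; destruct (Nat.le_ge_cases q p); [apply L; lia|].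
  rewrite Nat.eqb_sym, <- L by lia; apply sum1_ext; intros; ring.
Qed.

Lemma sin_node_flip M p m : (p <= S M)%nat ->
  (-1) ^ m * sin (INR p * node (S M) m) = - sin (INR (S M - p) * node (S M) m).
Proof.
  intros Hp. assert (0 < INR (S M)) by (apply lt_0_INR; lia).
  rewrite minus_INR, Rmult_minus_distr_r by lia.
  replace (INR (S M) * node (S M) m) with (INR m * PI) by (unfold node; field; lra).
  destruct (cos_sin_INR_PI m) as [E1 E2]; rewrite sin_minus, E1, E2; ring.
Qed.

(** The sign (-1)^m turns the frequency p into S M - p, up to a minus sign, which reduces the claim
    to plain orthogonality. *)
Lemma sin_node_alternating M p q : (1 <= p <= M)%nat -> (1 <= q <= M)%nat ->
  sum1 (fun m => (-1) ^ m * (sin (INR p * node (S M) m) * sin (INR q * node (S M) m))) M =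
  if Nat.eqb (p + q) (S M) then - (INR (S M) / 2) else 0.
Proof.
  intros Hp Hq.
  rewrite (sum1_ext _ (fun m => (-1) * (sin (INR (S M - p) * node (S M) m)
                                      * sin (INR q * node (S M) m)))).
  2: { intros m _; rewrite <- Rmult_assoc, sin_node_flip by lia; ring. }
  rewrite sum1_scal, sin_node_orthogonal by lia.
  destruct (Nat.eqb_spec (S M - p) q), (Nat.eqb_spec (p + q) (S M)); try lia; ring.
Qed.

(** Induction on [K]: the new frequency adds its own square, and its cross terms with the earlier
    ones vanish by orthogonality. *)
Lemma sin_node_parseval M K e : (K <= M)%nat ->
  sum1 (fun m => sum1 (fun q => sin (INR q * node (S M) m) * e q) K ^ 2) M =
  INR (S M) / 2 * sum1 (fun q => e q ^ 2) K.
Proof.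
  induction K as [|K IH]; intros HK.
  - simpl. rewrite (sum1_ext _ (fun _ => 0)) by (intros; ring).
    rewrite sum1_zero; ring.
  - cbn [sum1].
    rewrite (sum1_ext _ (fun m =>
      (sum1 (fun q => sin (INR q * node (S M) m) * e q) K) ^ 2
      + (2 * e (S K) * sum1 (fun q => e q * (sin (INR q * node (S M) m)
                                  * sin (INR (S K) * node (S M) m))) K
      + e (S K) ^ 2 * (sin (INR (S K) * node (S M) m) * sin (INR (S K) * node (S M) m))))).
    2: { intros m _.
         rewrite (sum1_ext (fun q => e q * _) (fun q => sin (INR (S K) * node (S M) m) *
            (sin (INR q * node (S M) m) * e q))) by (intros; ring).
         rewrite sum1_scal; ring. }
    rewrite !sum1_plus, !sum1_scal, IH, sum1_swap, sin_node_orthogonal, Nat.eqb_refl by lia.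
    rewrite (sum1_ext (fun j => sum1 _ M) (fun _ => 0)).
    2: { intros q Hq; rewrite sum1_scal, sin_node_orthogonal by lia.
         destruct (Nat.eqb_spec q (S K)); [lia | ring]. }
    rewrite sum1_zero; field.
Qed.

(** * The reproducing kernel *)

Definition sinker (N : nat) (x y a b : R) : R :=
  sum1 (fun q => chebU y q * sin (INR q * b) *
                 sum1 (fun p => chebU x p * sin (INR p * a)) (N - q)) N.

Lemma sinker_swap N x y a b : sinker N x y a b = sinker N y x b a.
Proof.
  unfold sinker.
  rewrite (sum1_ext _ (fun q => sum1 (fun p => chebU y q * sin (INR q * b) *
              (chebU x p * sin (INR p * a))) (N - q)))
    by (intros; rewrite sum1_scal; reflexivity).
  rewrite sum1_triangle_swap; apply sum1_ext; intros p Hp.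
  rewrite <- sum1_scal; apply sum1_ext; intros; ring.
Qed.

(** The Christoffel-Darboux formula multiplied by sin a. The sines obey the same three-term
    recurrence as [chebU], so no division by sin a occurs. *)
Lemma christoffel_darboux x a M :
  2 * (cos a - x) * sum1 (fun p => chebU x p * sin (INR p * a)) M =
  chebU x M * sin (INR (S M) * a) - chebU x (S M) * sin (INR M * a).
Proof.
  induction M as [|M IH]; [simpl; rewrite !Rmult_0_l, sin_0; ring|].
  cbn [sum1]; rewrite Rmult_plus_distr_l, IH, sin_mul_rec, (chebU_rec x M); ring.
Qed.

Lemma sinker_mul_x N x y a b :
  2 * (cos a - x) * sinker N x y a b =
  sum1 (fun q => sin (INR q * b) * (chebU y q *
    (chebU x (N - q) * sin (INR (S (N - q)) * a)
     - chebU x (S (N - q)) * sin (INR (N - q) * a)))) N.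
Proof.
  unfold sinker; rewrite <- sum1_scal; apply sum1_ext; intros q _.
  rewrite <- christoffel_darboux; ring.
Qed.

(** Christoffel-Darboux is applied in p for the x part and, through [sinker_swap], in q for the y
    part. Both are then written as sine sums in b, the form that Parseval needs, and their
    coefficients merge into the differences bounded by [chebU_cross_bound]. *)
Lemma sinker_mul_diff N x y a b :
  2 * (cos a - x - (cos b - y)) * sinker N x y a b =
  sum1 (fun q => sin (INR q * b) *
    (sin (INR (S (N - q)) * a) *
       (chebU y q * chebU x (N - q) - chebU x (S (N - q)) * chebU y (q - 1))
     + sin (INR (N - q) * a) *
       (chebU x (N - q) * chebU y (S q) - chebU y q * chebU x (S (N - q))))) N.
Proof.
  replace (2 * (cos a - x - (cos b - y)) * sinker N x y a b) with
    (2 * (cos a - x) * sinker N x y a b - 2 * (cos b - y) * sinker N y x b a)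
    by (rewrite (sinker_swap N y x); ring).
  rewrite !sinker_mul_x. destruct N as [|N]; [simpl; ring|].
  rewrite (sum1_ext (fun q => sin (INR q * a) * _) (fun p =>
     sin (INR p * a) * chebU x p * chebU y (S N - p) * sin (INR (S (S N - p)) * b)
     + (-1) * (sin (INR p * a) * chebU x p * chebU y (S (S N - p)) * sin (INR (S N - p) * b))))
    by (intros; ring).
  rewrite sum1_plus, sum1_scal.
  (* Reindexing by the frequency of b: here q = S (S N - p), which maps the range onto itself. *)
  assert (E1 : sum1 (fun p => sin (INR p * a) * chebU x p * chebU y (S N - p)
                     * sin (INR (S (S N - p)) * b)) (S N)
     = sum1 (fun q => sin (INR (S (S N - q)) * a) * chebU x (S (S N - q)) * chebU y (q - 1)
                     * sin (INR q * b)) (S N)).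
  { rewrite sum1_rev; apply sum1_ext; intros q Hq.
    replace (S N + 1 - q)%nat with (S (S N - q)) by lia.
    replace (S N - S (S N - q))%nat with (q - 1)%nat by lia.
    replace (S (q - 1)) with q by lia; reflexivity. }
  (* Here q = S N - p runs only over 1, ..., N; the last term on either side has frequency 0 and
     vanishes. *)
  assert (E2 : sum1 (fun p => sin (INR p * a) * chebU x p * chebU y (S (S N - p))
                     * sin (INR (S N - p) * b)) (S N)
     = sum1 (fun q => sin (INR (S N - q) * a) * chebU x (S N - q) * chebU y (S q)
                     * sin (INR q * b)) (S N)).
  { cbn [sum1]; rewrite Nat.sub_diag; simpl (INR 0); rewrite !Rmult_0_l, sin_0.
    rewrite !Rmult_0_r, !Rmult_0_l; f_equal.
    rewrite sum1_rev; apply sum1_ext; intros q Hq.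
    replace (N + 1 - q)%nat with (S N - q)%nat by lia.
    replace (S N - (S N - q))%nat with q by lia; reflexivity. }
  rewrite E1, E2, <- sum1_scal, <- sum1_plus.
  unfold Rminus at 1.
  match goal with |- _ + - ?s = _ => replace (- s) with (-1 * s) by ring end.
  rewrite <- sum1_scal, <- sum1_plus; apply sum1_ext; intros q Hq; ring.
Qed.

(** * Weighted quadratic bounds for the kernel on the full grid *)

Definition grid (N : nat) (f : R -> R -> R) : R :=
  sum1 (fun m => sum1 (fun l => f (node N m) (node (S N) l)) N) (N - 1).

Lemma grid_plus N f g : grid N (fun a b => f a b + g a b) = grid N f + grid N g.
Proof.
  unfold grid; rewrite <- sum1_plus; apply sum1_ext; intros; apply sum1_plus.
Qed.

Lemma grid_scal N c f : grid N (fun a b => c * f a b) = c * grid N f.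
Proof.
  unfold grid; rewrite <- sum1_scal; apply sum1_ext; intros; apply sum1_scal.
Qed.

(** Parseval is used in b alone, so the coefficients may depend on a in any way. The N - 1 values of
    a each contribute at most (N + 1) / 2 times N c, and (N - 1)(N + 1) <= N^2. *)
Lemma grid_sin_bound N (F : R -> R -> R) (e : nat -> R -> R) c :
  (1 <= N)%nat -> 0 <= c ->
  (forall a b, F a b = sum1 (fun q => sin (INR q * b) * e q a) N) ->
  (forall a q, (1 <= q <= N)%nat -> e q a ^ 2 <= c) ->
  grid N (fun a b => F a b ^ 2) <= c / 2 * INR N ^ 3.
Proof.
  intros HN Hc HF He. unfold grid.
  apply Rle_trans with (INR (N - 1) * (INR (S N) / 2 * (INR N * c))).
  - apply sum1_le_const; intros m _.
    rewrite (sum1_ext _ (fun l => sum1 (fun q =>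
      sin (INR q * node (S N) l) * e q (node N m)) N ^ 2)) by (intros; rewrite HF; reflexivity).
    rewrite sin_node_parseval by lia.
    apply Rmult_le_compat_l; [pose proof (pos_INR (S N)); lra|].
    apply sum1_le_const; intros q Hq; apply He; exact Hq.
  - rewrite (S_INR N), minus_INR by lia; simpl (INR 1). pose proof (pos_INR N).
    assert (0 <= INR N * c) by nra. lra.
Qed.

Lemma chebU_sqr_le x p N : 0 <= x <= 1 -> (p <= N)%nat -> chebU x p ^ 2 <= 4 * INR N ^ 2.
Proof.
  intros Hx Hp. replace (4 * INR N ^ 2) with ((2 * INR N) ^ 2) by ring.
  apply pow_maj_Rabs. pose proof (chebU_bound x p Hx). apply le_INR in Hp; lra.
Qed.

Lemma sin_comb_sqr_le s t r1 r2 : -1 <= s <= 1 -> -1 <= t <= 1 ->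
  (s * r1 + t * r2) ^ 2 <= 2 * r1 ^ 2 + 2 * r2 ^ 2.
Proof.
  intros Hs Ht.
  assert (0 <= (s * r1 - t * r2) ^ 2) by apply pow2_ge_0.
  assert (0 <= (1 - s ^ 2) * r1 ^ 2) by (apply Rmult_le_pos; [nra|apply pow2_ge_0]).
  assert (0 <= (1 - t ^ 2) * r2 ^ 2) by (apply Rmult_le_pos; [nra|apply pow2_ge_0]).
  nra.
Qed.

(* With first differences bounded by 2, the Wronskian-like combination is of order [k]
   although each product may be of order [k ^ 2]. *)
Lemma chebU_cross_bound x y i j k : 0 <= x <= 1 -> 0 <= y <= 1 ->
  (i <= k)%nat -> (j <= k)%nat ->
  (chebU y (S j) * chebU x i - chebU x (S i) * chebU y j) ^ 2 <= 64 * INR k ^ 2.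
Proof.
  intros Hx Hy Hi Hj. replace (64 * INR k ^ 2) with ((8 * INR k) ^ 2) by ring.
  apply pow_maj_Rabs.
  replace (_ - _) with ((chebU y (S j) - chebU y j) * chebU x i
                        - (chebU x (S i) - chebU x i) * chebU y j) by ring.
  eapply Rle_trans; [apply Rabs_triang|]. rewrite Rabs_Ropp, !Rabs_mult.
  pose proof (chebU_diff_bound x i Hx). pose proof (chebU_diff_bound y j Hy).
  pose proof (chebU_bound x i Hx). pose proof (chebU_bound y j Hy).
  apply le_INR in Hi; apply le_INR in Hj.
  pose proof (Rabs_pos (chebU x i)). pose proof (Rabs_pos (chebU y j)).
  pose proof (Rabs_pos (chebU x (S i) - chebU x i)).
  pose proof (Rabs_pos (chebU y (S j) - chebU y j)). nra.
Qed.

Lemma grid_sinker_diff N x y : (1 <= N)%nat -> 0 <= x <= 1 -> 0 <= y <= 1 ->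
  grid N (fun a b => (2 * (cos a - x - (cos b - y)) * sinker N x y a b) ^ 2)
  <= 128 * INR N ^ 5.
Proof.
  intros HN Hx Hy. pose proof (pow2_ge_0 (INR N)).
  replace (128 * INR N ^ 5) with (256 * INR N ^ 2 / 2 * INR N ^ 3) by field.
  eapply grid_sin_bound; [exact HN | nra | intros; apply sinker_mul_diff |].
  intros a q Hq; cbn beta.
  eapply Rle_trans; [apply sin_comb_sqr_le; apply SIN_bound|].
  assert (H1 : (chebU y q * chebU x (N - q) - chebU x (S (N - q)) * chebU y (q - 1)) ^ 2
               <= 64 * INR N ^ 2).
  { replace (chebU y q) with (chebU y (S (q - 1))) by (f_equal; lia).
    apply chebU_cross_bound; auto; lia. }
  assert (H2 : (chebU x (N - q) * chebU y (S q) - chebU y q * chebU x (S (N - q))) ^ 2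
               <= 64 * INR N ^ 2).
  { rewrite (Rmult_comm (chebU x (N - q))), (Rmult_comm (chebU y q)).
    apply chebU_cross_bound; auto; lia. }
  lra.
Qed.

(* [edge] is [1 - x] regularised at the scale [N^-2] at which the Chebyshev nodes cluster. *)
Definition edge (N : nat) (x : R) : R := 1 - x + / INR N ^ 2.

Lemma edge_bounds N x : (1 <= N)%nat -> 0 <= x <= 1 ->
  0 < / INR N ^ 2 <= 1 /\ / INR N ^ 2 <= edge N x <= 2.
Proof.
  intros HN Hx. apply le_INR in HN; simpl in HN.
  assert (1 <= INR N ^ 2) by nra.
  assert (0 < / INR N ^ 2) by (apply Rinv_0_lt_compat; lra).
  assert (/ INR N ^ 2 <= / 1) by (apply Rinv_le_contravar; lra).
  rewrite Rinv_1 in *; unfold edge; lra.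
Qed.

(** Each edge factor absorbs the square in its own variable (at most 5), and the other square is at
    most 4 N^2; the two summands give 20 N^2 each. *)
Lemma chebU_prod_edge x y i j N : (1 <= N)%nat -> 0 <= x <= 1 -> 0 <= y <= 1 ->
  (i <= N)%nat -> (j <= N)%nat ->
  chebU y j ^ 2 * chebU x i ^ 2 * (edge N x + edge N y) <= 40 * INR N ^ 2.
Proof.
  intros HN Hx Hy Hi Hj.
  pose proof (chebU_weight_bound x i N Hx Hi HN) as H1.
  pose proof (chebU_weight_bound y j N Hy Hj HN) as H2.
  fold (edge N x) in H1; fold (edge N y) in H2.
  pose proof (chebU_sqr_le x i N Hx Hi). pose proof (chebU_sqr_le y j N Hy Hj).
  pose proof (pow2_ge_0 (chebU x i)). pose proof (pow2_ge_0 (chebU y j)).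
  set (u := chebU x i ^ 2) in *; set (v := chebU y j ^ 2) in *.
  assert (v * (u * edge N x) <= v * 5) by (apply Rmult_le_compat_l; lra).
  assert (u * (v * edge N y) <= u * 5) by (apply Rmult_le_compat_l; lra).
  lra.
Qed.

Lemma grid_sinker_x N x y : (1 <= N)%nat -> 0 <= x <= 1 -> 0 <= y <= 1 ->
  (edge N x + edge N y) * grid N (fun a b => (2 * (cos a - x) * sinker N x y a b) ^ 2)
  <= 80 * INR N ^ 5.
Proof.
  intros HN Hx Hy.
  pose proof (edge_bounds N x HN Hx); pose proof (edge_bounds N y HN Hy).
  set (P := edge N x + edge N y). assert (HP : 0 < P) by (unfold P; lra).
  pose proof (pow2_ge_0 (INR N)).
  (* The coefficient bound to feed into [grid_sin_bound] is 160 N^2 / P, with 160 = 2 * 40 + 2 * 40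
     from [sin_comb_sqr_le] and [chebU_prod_edge]. *)
  replace (80 * INR N ^ 5) with (P * (160 * INR N ^ 2 / P / 2 * INR N ^ 3)) by (field; lra).
  apply Rmult_le_compat_l; [lra|].
  eapply grid_sin_bound; [exact HN | | intros; apply sinker_mul_x |].
  { apply Rmult_le_pos; [lra | apply Rlt_le, Rinv_0_lt_compat; exact HP]. }
  intros a q Hq; cbn beta.
  apply Rmult_le_reg_r with P; [exact HP|].
  replace (160 * INR N ^ 2 / P * P) with (160 * INR N ^ 2) by (field; lra).
  pose proof (chebU_prod_edge x y (N - q) q N HN Hx Hy ltac:(lia) ltac:(lia)) as G1.
  pose proof (chebU_prod_edge x y (S (N - q)) q N HN Hx Hy ltac:(lia) ltac:(lia)) as G2.
  fold P in G1, G2.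
  pose proof (sin_comb_sqr_le (sin (INR (S (N - q)) * a)) (sin (INR (N - q) * a))
     (chebU x (N - q)) (- chebU x (S (N - q))) (SIN_bound _) (SIN_bound _)) as G3.
  set (u := chebU x (N - q)) in *; set (u' := chebU x (S (N - q))) in *.
  set (v := chebU y q) in *.
  replace (v * (u * sin (INR (S (N - q)) * a) - u' * sin (INR (N - q) * a))) with
    (v * (sin (INR (S (N - q)) * a) * u + sin (INR (N - q) * a) * (- u'))) by ring.
  rewrite Rpow_mult_distr.
  assert (G4 : 0 <= v ^ 2 * P) by (apply Rmult_le_pos; [apply pow2_ge_0|lra]).
  apply (Rmult_le_compat_l _ _ _ G4) in G3. lra.
Qed.

(** Parseval in both variables evaluates the square sum exactly, as a triangular sum of products of
    squares of [chebU]. Each product times both edge factors is at most 5 * 5. *)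
Lemma grid_sinker_const N x y : (1 <= N)%nat -> 0 <= x <= 1 -> 0 <= y <= 1 ->
  edge N x * edge N y * grid N (fun a b => sinker N x y a b ^ 2) <= 13 * INR N ^ 4.
Proof.
  intros HN Hx Hy.
  pose proof (edge_bounds N x HN Hx); pose proof (edge_bounds N y HN Hy).
  set (P := edge N x) in *; set (Q := edge N y) in *.
  destruct N as [|M]; [lia|].
  assert (HM : 1 <= INR (S M)) by (apply le_INR in HN; exact HN).
  assert (E : grid (S M) (fun a b => sinker (S M) x y a b ^ 2) =
    INR (S (S M)) / 2 * (INR (S M) / 2 *
    sum1 (fun q => chebU y q ^ 2 * sum1 (fun p => chebU x p ^ 2) (S M - q)) (S M))).
  { unfold grid. simpl (S M - 1)%nat; rewrite Nat.sub_0_r.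
    set (D := fun q a => sum1 (fun p => sin (INR p * a) * chebU x p) (S M - q)).
    rewrite (sum1_ext _ (fun m => INR (S (S M)) / 2 *
       sum1 (fun q => chebU y q ^ 2 * D q (node (S M) m) ^ 2) (S M))).
    2: { intros m _. unfold sinker.
         rewrite (sum1_ext _ (fun l => sum1 (fun q => sin (INR q * node (S (S M)) l) *
                      (chebU y q * D q (node (S M) m))) (S M) ^ 2)).
         - rewrite sin_node_parseval by lia; f_equal; apply sum1_ext; intros; ring.
         - intros l _; f_equal; apply sum1_ext; intros q _; unfold D.
           rewrite (sum1_ext (fun p => sin _ * _) (fun p => chebU x p * sin (INR p * node (S M) m)))
             by (intros; ring). ring. }
    rewrite sum1_scal, sum1_swap, <- (sum1_scal (INR (S M) / 2)); f_equal.
    apply sum1_ext; intros q Hq; unfold D.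
    rewrite sum1_scal, sin_node_parseval by lia; ring. }
  rewrite E.
  set (s := sum1 _ (S M)).
  assert (Hs : P * Q * s <= INR (S M) * (INR (S M) * 25)).
  { unfold s; rewrite <- sum1_scal; apply sum1_le_const; intros q Hq.
    rewrite <- Rmult_assoc, <- sum1_scal.
    apply Rle_trans with (INR (S M - q) * 25).
    - apply sum1_le_const; intros p Hp.
      pose proof (chebU_weight_bound x p (S M) Hx ltac:(lia) HN) as H1.
      pose proof (chebU_weight_bound y q (S M) Hy ltac:(lia) HN) as H2.
      change (chebU x p ^ 2 * P <= 5) in H1; change (chebU y q ^ 2 * Q <= 5) in H2.
      pose proof (pow2_ge_0 (chebU x p)); pose proof (pow2_ge_0 (chebU y q)).
      assert (0 <= chebU x p ^ 2 * P) by (apply Rmult_le_pos; lra).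
      assert (0 <= chebU y q ^ 2 * Q) by (apply Rmult_le_pos; lra).
      replace (P * Q * chebU y q ^ 2 * chebU x p ^ 2) with
        ((chebU x p ^ 2 * P) * (chebU y q ^ 2 * Q)) by ring.
      replace 25 with (5 * 5) by ring; apply Rmult_le_compat; lra.
    - apply Rmult_le_compat_r; [lra|]; apply le_INR; lia. }
  rewrite (S_INR (S M)).
  set (n := INR (S M)) in *.
  replace (P * Q * ((n + 1) / 2 * (n / 2 * s))) with ((n + 1) * n / 4 * (P * Q * s)) by field.
  apply Rle_trans with ((n + 1) * n / 4 * (n * (n * 25))).
  - apply Rmult_le_compat_l; [nra | exact Hs].
  - assert (0 <= n ^ 3 * (n - 1)) by (apply Rmult_le_pos; [apply pow_le|]; lra).
    assert (0 <= n ^ 4) by (apply pow_le; lra). nra.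
Qed.

(** The powers of N balance the three grid estimates, of orders N^5, N^5 and N^4, so that every term
    contributes O(N^6). *)
Definition rho (N : nat) (x y a b : R) : R :=
  INR N * (cos a - x - (cos b - y)) ^ 2
  + INR N * (edge N x + edge N y) * (cos a - x) ^ 2
  + INR N ^ 2 * (edge N x * edge N y).

Lemma grid_rho_sinker N x y : (1 <= N)%nat -> 0 <= x <= 1 -> 0 <= y <= 1 ->
  grid N (fun a b => rho N x y a b * sinker N x y a b ^ 2) <= 65 * INR N ^ 6.
Proof.
  intros HN Hx Hy.
  pose proof (grid_sinker_diff N x y HN Hx Hy) as H1.
  pose proof (grid_sinker_x N x y HN Hx Hy) as H2.
  pose proof (grid_sinker_const N x y HN Hx Hy) as H3.
  assert (E : grid N (fun a b => rho N x y a b * sinker N x y a b ^ 2) =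
    INR N / 4 * grid N (fun a b => (2 * (cos a - x - (cos b - y)) * sinker N x y a b) ^ 2)
    + (INR N / 4 * ((edge N x + edge N y) *
            grid N (fun a b => (2 * (cos a - x) * sinker N x y a b) ^ 2))
    + INR N ^ 2 * (edge N x * edge N y * grid N (fun a b => sinker N x y a b ^ 2)))).
  { rewrite <- !grid_scal, <- !grid_plus; unfold grid.
    apply sum1_ext; intros m _; apply sum1_ext; intros l _; unfold rho; field. }
  rewrite E. apply le_INR in HN; simpl in HN.
  apply Rmult_le_compat_l with (r := INR N / 4) in H1; [|lra].
  apply Rmult_le_compat_l with (r := INR N / 4) in H2; [|lra].
  apply Rmult_le_compat_l with (r := INR N ^ 2) in H3; [|nra].
  assert (0 <= INR N ^ 6) by (apply pow_le; lra). lra.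
Qed.

(** * Summing the reciprocal weights *)

(** The function [g] is a rational stand-in for the arctangent: it stays in [-1, 1], and four times
    its increment over a unit step dominates the summand, so the sum telescopes. *)
Lemma sum_inv_quadratic_bound c n : sum1 (fun l => / (1 + (INR l - c) ^ 2)) n <= 8.
Proof.
  set (g := fun z => z / (1 + Rabs z)).
  assert (Hg : forall z, -1 <= g z <= 1).
  { intros z; unfold g. pose proof (Rabs_pos z). pose proof (Rle_abs z).
    pose proof (Rle_abs (- z)) as H1; rewrite Rabs_Ropp in H1.
    split; apply Rmult_le_reg_r with (1 + Rabs z); try lra;
      unfold Rdiv; rewrite Rmult_assoc, Rinv_l; lra. }
  assert (step : forall z, / (1 + z ^ 2) <= 4 * (g (z + 1) - g z)).
  { assert (K : forall p q r, 0 < p -> 0 < r -> r <= 4 * q * p -> / p <= 4 * (q / r)).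
    { intros p q r Hp Hr H. apply Rmult_le_reg_l with (p * r); [nra|].
      replace (p * r * / p) with r by (field; lra).
      replace (p * r * (4 * (q / r))) with (4 * q * p) by (field; lra). exact H. }
    intros z; unfold g. destruct (Rle_dec 0 z) as [Hz|Hz].
    - rewrite !Rabs_pos_eq by lra.
      replace ((z + 1) / (1 + (z + 1)) - z / (1 + z)) with (1 / ((1 + z) * (2 + z)))
        by (field; lra).
      apply K; nra.
    - destruct (Rle_dec z (-1)) as [Hz'|Hz'].
      + rewrite !Rabs_left1 by lra.
        replace ((z + 1) / (1 + - (z + 1)) - z / (1 + - z)) with (1 / ((- z) * (1 - z)))
          by (field; lra).
        apply K; nra.
      + rewrite (Rabs_left1 z), (Rabs_pos_eq (z + 1)) by lra.
        replace ((z + 1) / (1 + (z + 1)) - z / (1 + - z)) with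
          ((1 - 2 * z - 2 * z ^ 2) / ((2 + z) * (1 - z))) by (field; lra).
        apply K; nra. }
  clearbody g.
  assert (H : sum1 (fun l => / (1 + (INR l - c) ^ 2)) n <= 4 * (g (INR n + 1 - c) - g (1 - c))).
  { induction n as [|n IH]; [simpl; replace (0 + 1 - c) with (1 - c) by ring; lra|].
    cbn [sum1]; pose proof (step (INR (S n) - c)) as Hs.
    replace (INR (S n) - c + 1) with (INR (S n) + 1 - c) in Hs by ring.
    rewrite <- S_INR in IH.
    lra. }
  pose proof (Hg (INR n + 1 - c)); pose proof (Hg (1 - c)); lra.
Qed.

(** From sin z >= z - z^3 / 6, since PI <= 4 gives z <= 2. *)
Lemma third_le_sin z : 0 <= z <= PI / 2 -> z / 3 <= sin z.
Proof.
  intros Hz. pose proof PI_4.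
  destruct (pre_sin_bound z 0 ltac:(lra) ltac:(lra)) as [H1 _].
  unfold sin_approx, sin_term in H1; simpl in H1.
  apply Rle_trans with (2 := H1).
  assert (0 <= z * (4 - z ^ 2)) by (apply Rmult_le_pos; nra). simpl in *; nra.
Qed.

(** Factor cos a - cos b into half-angle sines. The difference factor controls a - b by
    [third_le_sin], and sin a <= sin a + sin b <= 2 sin ((a + b) / 2) handles the other. *)
Lemma sin_mul_angle_le a b : 0 <= a <= PI -> 0 <= b <= PI ->
  (sin a * (a - b)) ^ 2 <= 36 * (cos a - cos b) ^ 2.
Proof.
  intros Ha Hb.
  assert (H1 : (a - b) ^ 2 <= 36 * sin ((a - b) / 2) ^ 2).
  { assert (L : forall z, 0 <= z <= PI / 2 -> (2 * z) ^ 2 <= 36 * sin z ^ 2)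
      by (intros z Hz; pose proof (third_le_sin z Hz); nra).
    destruct (Rle_dec b a).
    - replace ((a - b) ^ 2) with ((2 * ((a - b) / 2)) ^ 2) by field; apply L; lra.
    - replace ((a - b) / 2) with (- ((b - a) / 2)) by field; rewrite sin_neg.
      replace ((a - b) ^ 2) with ((2 * ((b - a) / 2)) ^ 2) by field.
      replace ((- sin ((b - a) / 2)) ^ 2) with (sin ((b - a) / 2) ^ 2) by ring.
      apply L; lra. }
  assert (H2 : 0 <= sin a <= 2 * sin ((a + b) / 2)).
  { pose proof (sin_ge_0 a ltac:(lra) ltac:(lra)).
    pose proof (sin_ge_0 b ltac:(lra) ltac:(lra)).
    pose proof (sin_ge_0 ((a + b) / 2) ltac:(lra) ltac:(lra)).
    pose proof (form3 a b) as E. pose proof (COS_bound ((a - b) / 2)). nra. }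
  rewrite form2.
  replace (36 * _) with ((2 * sin ((a + b) / 2)) ^ 2 * (36 * sin ((a - b) / 2) ^ 2)) by ring.
  rewrite Rpow_mult_distr.
  apply Rmult_le_compat; try apply pow2_ge_0; [apply pow_incr; exact H2 | exact H1].
Qed.

Lemma sin_mul_angle_le_level t : exists b, forall a, 0 <= a <= PI ->
  (sin a * (a - b)) ^ 2 <= 36 * (cos a - t) ^ 2.
Proof.
  pose proof PI_RGT_0.
  (* [t] may lie outside [-1, 1]; clamping it to that interval only brings it closer to every
     cosine. *)
  assert (E : exists b, 0 <= b <= PI /\ forall a, (cos a - cos b) ^ 2 <= (cos a - t) ^ 2).
  { destruct (Rle_dec t 1) as [H1|H1]; [destruct (Rle_dec (-1) t) as [H2|H2]|].
    - exists (acos t); split; [apply acos_bound|].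
      intros a; rewrite cos_acos by lra; apply Rle_refl.
    - exists PI; split; [lra|]; intros a; rewrite cos_PI.
      pose proof (COS_bound a); nra.
    - exists 0; split; [lra|]; intros a; rewrite cos_0.
      pose proof (COS_bound a); nra. }
  destruct E as [b [Hb Hab]]; exists b; intros a Ha.
  eapply Rle_trans; [apply sin_mul_angle_le; assumption|].
  specialize (Hab a); lra.
Qed.

Lemma node_bounds N m : (1 <= N)%nat -> (m <= N)%nat -> 0 <= node N m <= PI.
Proof.
  intros HN Hm; unfold node; pose proof PI_RGT_0; pose proof (pos_INR m).
  assert (0 < INR N) by (apply lt_0_INR; lia). apply le_INR in Hm.
  split; apply Rmult_le_reg_r with (INR N); try lra;
    unfold Rdiv; rewrite Rmult_assoc, Rinv_l by lra; nra.
Qed.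

(** * The sine weight against [rho], and the bound for x, y in [0, 1] *)

Lemma sin_sqr_le_edge a : sin a ^ 2 <= 2 * (1 - cos a).
Proof.
  pose proof (sin2_cos2 a) as H; unfold Rsqr in H. pose proof (COS_bound a). nra.
Qed.

(** By [sin_sqr_le_edge] the left side is at most 4 (P + |X|)(Q + |Y|). Expanded, PQ costs r, P|Y|
    and Q|X| cost 5 r each, and |X||Y| costs 9/2 n r; with r <= n r the total is 4 (11 + 9/2) =
    62. *)
Lemma weight_le_rho N x y a b : (1 <= N)%nat -> 0 <= x <= 1 -> 0 <= y <= 1 ->
  (sin a * sin b) ^ 2 <= 62 * INR N * rho N x y a b.
Proof.
  intros HN Hx Hy. unfold rho.
  pose proof (edge_bounds N x HN Hx) as [Hi HP]; pose proof (edge_bounds N y HN Hy) as [_ HQ].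
  assert (HAP : 1 - x <= edge N x) by (unfold edge; lra).
  assert (HBQ : 1 - y <= edge N y) by (unfold edge; lra).
  apply le_INR in HN; simpl in HN.
  assert (Ei : INR N ^ 2 * / INR N ^ 2 = 1) by (field; lra).
  pose proof (sin_sqr_le_edge a) as Sa; pose proof (sin_sqr_le_edge b) as Sb.
  pose proof (pow2_ge_0 (sin a)); pose proof (pow2_ge_0 (sin b)).
  rewrite Rpow_mult_distr.
  set (n := INR N) in *; set (i := / n ^ 2) in *.
  set (P := edge N x) in *; set (Q := edge N y) in *.
  replace (1 - cos a) with ((1 - x) - (cos a - x)) in Sa by ring.
  replace (1 - cos b) with ((1 - y) - (cos b - y)) in Sb by ring.
  set (X := cos a - x) in *; set (Y := cos b - y) in *.
  set (A := 1 - x) in *; set (B := 1 - y) in *.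
  set (r := n * (X - Y) ^ 2 + n * (P + Q) * X ^ 2 + n ^ 2 * (P * Q)).
  pose proof (pow2_ge_0 X); pose proof (pow2_ge_0 Y); pose proof (pow2_ge_0 (X - Y)).
  assert (HPQ : 0 <= n ^ 2 * (P * Q)) by (repeat apply Rmult_le_pos; lra).
  assert (r1 : n ^ 2 * (P * Q) <= r).
  { unfold r. assert (0 <= n * (X - Y) ^ 2) by (apply Rmult_le_pos; lra).
    assert (0 <= n * (P + Q)) by nra. assert (0 <= n * (P + Q) * X ^ 2) by nra. lra. }
  assert (r2 : n * ((P + Q) * (X ^ 2 + Y ^ 2)) <= 9 * r).
  { assert (E : (P + Q) * (X ^ 2 + Y ^ 2) <= 3 * ((P + Q) * X ^ 2) + 8 * (X - Y) ^ 2).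
    { assert (Y ^ 2 <= 2 * X ^ 2 + 2 * (X - Y) ^ 2).
      { pose proof (pow2_ge_0 (2 * X - Y)); lra. }
      nra. }
    apply Rmult_le_compat_l with (r := n) in E; [|lra].
    assert (0 <= (P + Q) * X ^ 2) by nra. assert (0 <= n * ((P + Q) * X ^ 2)) by nra.
    assert (0 <= n * (X - Y) ^ 2) by nra. unfold r in *. nra. }
  assert (r0 : 0 <= r) by lra.
  assert (rn : r <= n * r) by nra.
  assert (Pr : P <= r /\ Q <= r).
  { assert (n ^ 2 * (P * i) <= n ^ 2 * (P * Q)) by (apply Rmult_le_compat_l; nra).
    assert (n ^ 2 * (Q * i) <= n ^ 2 * (P * Q)) by (apply Rmult_le_compat_l; nra).
    replace (n ^ 2 * (P * i)) with (P * (n ^ 2 * i)) in * by ring.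
    replace (n ^ 2 * (Q * i)) with (Q * (n ^ 2 * i)) in * by ring.
    rewrite Ei in *; lra. }
  (* P + Q is at least n^-2, the regularisation in [edge]; this costs the factor n. *)
  assert (sq : X ^ 2 + Y ^ 2 <= 9 * (n * r)).
  { assert (E : n ^ 2 * (i * (X ^ 2 + Y ^ 2)) <= n ^ 2 * ((P + Q) * (X ^ 2 + Y ^ 2)))
      by (apply Rmult_le_compat_l; nra).
    replace (n ^ 2 * (i * (X ^ 2 + Y ^ 2))) with ((n ^ 2 * i) * (X ^ 2 + Y ^ 2)) in E by ring.
    rewrite Ei in E. nra. }
  assert (lin : (P + Q) * (X ^ 2 + Y ^ 2) <= 9 * r).
  { assert (0 <= (P + Q) * (X ^ 2 + Y ^ 2)) by nra. nra. }
  assert (cA : forall Z, Z ^ 2 <= X ^ 2 + Y ^ 2 -> P * Rabs Z <= 5 * r /\ Q * Rabs Z <= 5 * r).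
  { intros Z HZ. assert (2 * Rabs Z <= 1 + Z ^ 2).
    { pose proof (pow2_ge_0 (Rabs Z - 1)). rewrite <- (pow2_abs Z); lra. }
    split; nra. }
  destruct (cA X ltac:(lra)) as [_ cX]; destruct (cA Y ltac:(lra)) as [cY _].
  assert (cXY : 2 * (Rabs X * Rabs Y) <= X ^ 2 + Y ^ 2).
  { pose proof (pow2_ge_0 (Rabs X - Rabs Y)). rewrite <- (pow2_abs X), <- (pow2_abs Y); lra. }
  apply Rle_trans with (2 * (P + Rabs X) * (2 * (Q + Rabs Y))).
  - pose proof (Rle_abs (- X)) as aX; pose proof (Rle_abs (- Y)) as aY.
    rewrite Rabs_Ropp in aX, aY.
    apply Rmult_le_compat; lra.
  - assert (P * Q <= n ^ 2 * (P * Q)).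
    { assert (0 <= P * Q) by (apply Rmult_le_pos; lra). assert (1 <= n ^ 2) by nra. nra. }
    lra.
Qed.

Lemma abs_le_am_gm z g h : 0 <= g -> 0 <= h -> z ^ 2 <= g * h -> Rabs z <= (g + h) / 2.
Proof.
  intros Hg Hh Hz. rewrite <- (Rabs_pos_eq ((g + h) / 2)) by lra.
  apply Rsqr_le_abs_0; unfold Rsqr. pose proof (pow2_ge_0 (g - h)). nra.
Qed.

Lemma rho_ge0 N x y a b : (1 <= N)%nat -> 0 <= x <= 1 -> 0 <= y <= 1 -> 0 <= rho N x y a b.
Proof.
  intros HN Hx Hy. pose proof (weight_le_rho N x y a b HN Hx Hy).
  pose proof (pow2_ge_0 (sin a * sin b)).
  apply le_INR in HN; simpl in HN. nra.
Qed.

(** AM-GM splits each term into a multiple of n^3 / (1 + (l - c)^2), summed by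
    [sum_inv_quadratic_bound], and rho S^2 / (2 n^2), summed by [grid_rho_sinker]. The two parts
    give 312 n^4 and 65/2 n^4. *)
Lemma grid_lebesgue_corner N x y : (1 <= N)%nat -> 0 <= x <= 1 -> 0 <= y <= 1 ->
  grid N (fun a b => Rabs (sin a * sin b * sinker N x y a b)) <= 345 * INR N ^ 4.
Proof.
  intros HN Hx Hy. set (n := INR N).
  assert (Hn : 1 <= n) by (apply le_INR in HN; exact HN).
  assert (S1 : forall m, (1 <= m <= N - 1)%nat ->
    sum1 (fun l => Rabs (sin (node N m) * sin (node (S N) l)
                         * sinker N x y (node N m) (node (S N) l))) N
    <= 312 * n ^ 3 + / (2 * n ^ 2) * sum1 (fun l => rho N x y (node N m) (node (S N) l)
                  * sinker N x y (node N m) (node (S N) l) ^ 2) N).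
  { intros m Hm. set (a := node N m).
    (* For fixed a, X = Y means that cos b equals this level. [c] is the corresponding angle in
       units of the grid step PI / (N + 1). *)
    destruct (sin_mul_angle_le_level (cos a - x + y)) as [b0 Hb0].
    set (c := b0 * INR (S N) / PI).
    (* 78 = 62 + 16 adds [weight_le_rho] and [Hfar]; 78 / 2 * 8 is the 312. *)
    apply Rle_trans with (sum1 (fun l => 78 / 2 * n ^ 3 * / (1 + (INR l - c) ^ 2)
       + / (2 * n ^ 2) * (rho N x y a (node (S N) l) * sinker N x y a (node (S N) l) ^ 2)) N).
    2: { rewrite sum1_plus, !sum1_scal.
         pose proof (sum_inv_quadratic_bound c N).
         assert (0 <= n ^ 3) by (apply pow_le; lra). apply Rplus_le_compat_r. nra. }
    apply sum1_le; intros l Hl. set (b := node (S N) l). set (s := sinker N x y a b).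
    pose proof (rho_ge0 N x y a b HN Hx Hy) as Hr.
    pose proof (weight_le_rho N x y a b HN Hx Hy) as Hw; fold n in Hw.
    set (k := 1 + (INR l - c) ^ 2). pose proof (pow2_ge_0 (INR l - c)) as Hk0.
    assert (Hk : 1 <= k) by (unfold k; lra).
    (* Only the (X - Y)^2 term of [rho] is used. The constant is 36 * 4 / 9, where 4 / 9 comes from
       n + 1 <= 2 n and PI > 3. *)
    assert (Hfar : (sin a * sin b) ^ 2 * (INR l - c) ^ 2 <= 16 * n * rho N x y a b).
    { specialize (Hb0 b (node_bounds (S N) l ltac:(lia) ltac:(lia))).
      pose proof PI2_3_2; assert (HPI : 3 < PI) by lra.
      assert (EN : INR (S N) = n + 1) by apply S_INR.
      replace ((sin a * sin b) ^ 2 * (INR l - c) ^ 2) with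
        (sin a ^ 2 * (sin b * (b - b0)) ^ 2 * ((n + 1) / PI) ^ 2)
        by (unfold b, c, node; rewrite EN; field; lra).
      assert (Hs : sin a ^ 2 <= 1) by (pose proof (SIN_bound a); nra).
      pose proof (pow2_ge_0 (sin a)). pose proof (pow2_ge_0 (sin b * (b - b0))).
      assert (Hq : ((n + 1) / PI) ^ 2 <= 4 / 9 * n ^ 2).
      { assert (0 <= (n + 1) / PI <= 2 / 3 * n).
        { split; [apply Rmult_le_pos; [lra|apply Rlt_le, Rinv_0_lt_compat; lra]|].
          apply Rmult_le_reg_r with PI; [lra|].
          unfold Rdiv at 1; rewrite Rmult_assoc, Rinv_l by lra. nra. }
        nra. }
      assert (HXY : n * (cos b - (cos a - x + y)) ^ 2 <= rho N x y a b).
      { unfold rho; fold n.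
        pose proof (edge_bounds N x HN Hx); pose proof (edge_bounds N y HN Hy).
        assert (0 <= n * (edge N x + edge N y) * (cos a - x) ^ 2)
          by (apply Rmult_le_pos; [nra|apply pow2_ge_0]).
        assert (0 <= n ^ 2 * (edge N x * edge N y)) by (apply Rmult_le_pos; nra).
        replace ((cos b - (cos a - x + y)) ^ 2) with ((cos a - x - (cos b - y)) ^ 2) by ring.
        lra. }
      apply Rle_trans with (36 * (cos b - (cos a - x + y)) ^ 2 * (4 / 9 * n ^ 2)).
      - apply Rmult_le_compat; [nra | apply pow2_ge_0 | nra | exact Hq].
      - nra. }
    replace (78 / 2 * n ^ 3 * / k + / (2 * n ^ 2) * (rho N x y a b * s ^ 2)) with
      ((78 * n ^ 3 / k + rho N x y a b * s ^ 2 / n ^ 2) / 2) by (field; lra).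
    assert (0 <= n ^ 3) by (apply pow_le; lra).
    pose proof (pow2_ge_0 s).
    apply abs_le_am_gm.
    - apply Rmult_le_pos; [lra | apply Rlt_le, Rinv_0_lt_compat; lra].
    - apply Rmult_le_pos; [nra | apply Rlt_le, Rinv_0_lt_compat; nra].
    - replace (78 * n ^ 3 / k * (rho N x y a b * s ^ 2 / n ^ 2)) with
        (78 * n * rho N x y a b / k * s ^ 2) by (field; lra).
      rewrite (Rpow_mult_distr _ s). apply Rmult_le_compat_r; [assumption|].
      apply Rmult_le_reg_r with k; [lra|].
      replace (78 * n * rho N x y a b / k * k) with (78 * n * rho N x y a b) by (field; lra).
      unfold k; lra. }
  pose proof (grid_rho_sinker N x y HN Hx Hy) as H6; fold n in H6. unfold grid in *.
  eapply Rle_trans; [apply sum1_le; exact S1|].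
  rewrite sum1_plus, sum1_const, sum1_scal, minus_INR by lia; fold n; simpl (INR 1).
  apply Rmult_le_compat_l with (r := / (2 * n ^ 2)) in H6.
  2: { apply Rlt_le, Rinv_0_lt_compat; nra. }
  replace (/ (2 * n ^ 2) * (65 * n ^ 6)) with (65 / 2 * n ^ 4) in H6 by (field; lra).
  assert (0 <= n ^ 3) by (apply pow_le; lra). assert (0 <= n ^ 4) by (apply pow_le; lra).
  lra.
Qed.

(** * Reflection symmetries of the full grid *)

Lemma sin_mul_reflect x a p :
  chebU (- x) p * sin (INR p * (PI - a)) = chebU x p * sin (INR p * a).
Proof.
  rewrite <- !chebU_cos, Rtrigo_facts.cos_pi_minus, Rtrigo_facts.sin_pi_minus.
  rewrite !chebU_opp.
  (* The parity sign of U_(p-1) appears once from x and once from cos a, and cancels. *)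
  transitivity ((-1) ^ S p * (-1) ^ S p * (chebU x p * chebU (cos a) p * sin a)); [ring|].
  rewrite neg1_sqr; ring.
Qed.

Lemma sinker_reflect_x N x y a b : sinker N (- x) y (PI - a) b = sinker N x y a b.
Proof.
  apply sum1_ext; intros q _; f_equal; apply sum1_ext; intros p _; apply sin_mul_reflect.
Qed.

Lemma sinker_reflect_y N x y a b : sinker N x (- y) a (PI - b) = sinker N x y a b.
Proof. rewrite !(sinker_swap N x); apply sinker_reflect_x. Qed.

Lemma node_reflect N m : (1 <= m <= N)%nat -> node N (N - m) = PI - node N m.
Proof.
  intros Hm; assert (0 < INR N) by (apply lt_0_INR; lia).
  unfold node; rewrite minus_INR by lia; field; lra.
Qed.

Lemma grid_reflect N (f : R -> R -> R) :
  grid N (fun a b => f (PI - a) b) = grid N f /\ grid N (fun a b => f a (PI - b)) = grid N f.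
Proof.
  unfold grid; split.
  - rewrite (sum1_rev (fun m => sum1 (fun l => f (node N m) _) N)).
    apply sum1_ext; intros m Hm; apply sum1_ext; intros l _.
    rewrite <- node_reflect by lia; do 2 f_equal; lia.
  - apply sum1_ext; intros m Hm.
    rewrite (sum1_rev (fun l => f (node N m) (node (S N) l))).
    apply sum1_ext; intros l Hl.
    rewrite <- node_reflect by lia; do 2 f_equal; lia.
Qed.

Lemma grid_ext N f g : (forall a b, f a b = g a b) -> grid N f = grid N g.
Proof. intros H; apply sum1_ext; intros; apply sum1_ext; intros; apply H. Qed.

(** Reflections move (x, y) into [0, 1]^2. For even N the half grid is not invariant under b -> PI -
    b, which swaps the parity of l; this is why the full grid is summed. *)
Lemma grid_lebesgue N x y : (1 <= N)%nat -> -1 <= x <= 1 -> -1 <= y <= 1 ->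
  grid N (fun a b => Rabs (sin a * sin b * sinker N x y a b)) <= 345 * INR N ^ 4.
Proof.
  set (F := fun x y a b => Rabs (sin a * sin b * sinker N x y a b)).
  assert (Fx : forall x y, grid N (F (- x) y) = grid N (F x y)).
  { intros u v; rewrite <- (proj1 (grid_reflect N (F (- u) v))).
    apply grid_ext; intros a b; unfold F.
    rewrite sinker_reflect_x, Rtrigo_facts.sin_pi_minus; reflexivity. }
  assert (Fy : forall x y, grid N (F x (- y)) = grid N (F x y)).
  { intros u v; rewrite <- (proj2 (grid_reflect N (F u (- v)))).
    apply grid_ext; intros a b; unfold F.
    rewrite sinker_reflect_y, Rtrigo_facts.sin_pi_minus; reflexivity. }
  intros HN Hx Hy. change (grid N (F x y) <= 345 * INR N ^ 4).
  assert (G : forall x y, 0 <= x <= 1 -> 0 <= y <= 1 -> grid N (F x y) <= 345 * INR N ^ 4)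
    by (intros; apply grid_lebesgue_corner; assumption).
  destruct (Rle_dec 0 x), (Rle_dec 0 y); [ | rewrite <- Fy | rewrite <- Fx | rewrite <- Fx, <- Fy];
    apply G; lra.
Qed.

(** * The Lagrange basis at the Morrow-Patterson points *)

Lemma pow_neg1_odd m : (-1) ^ m = if Nat.odd m then -1 else 1.
Proof.
  induction m as [|m IH]; [reflexivity|].
  rewrite Nat.odd_succ, <- Nat.negb_odd; simpl; rewrite IH.
  destruct (Nat.odd m); simpl; ring.
Qed.

(* The Morrow-Patterson points are [(cos (node N m), cos (node (S N) l))] with [N = n + 2] and
   [m + l] odd; the sign factor selects this half of the grid. *)
Definition mp_sum (N : nat) (g : nat -> nat -> R) : R :=
  sum1 (fun m => sum1 (fun l => (1 - (-1) ^ m * (-1) ^ l) / 2 * g m l) N) (N - 1).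

Definition mp_row (m k : nat) : nat := if Nat.odd m then (2 * k)%nat else (2 * k - 1)%nat.

(** Of each pair l = 2k - 1, 2k the sign factor keeps exactly one, namely [mp_row m k]. *)
Lemma sum1_mp_row m g K :
  sum1 (fun k => g (mp_row m k)) K =
  sum1 (fun l => (1 - (-1) ^ m * (-1) ^ l) / 2 * g l) (2 * K).
Proof.
  induction K as [|K IH]; [reflexivity|].
  replace (2 * S K)%nat with (S (S (2 * K))) by lia. cbn [sum1]; rewrite IH.
  rewrite !pow_neg1_odd, !Nat.odd_succ, Nat.even_succ.
  replace (Nat.even (2 * K)) with true by (symmetry; apply Nat.even_spec; exists K; lia).
  replace (Nat.odd (2 * K)) with false
    by (symmetry; rewrite <- Nat.negb_even; apply Bool.negb_false_iff, Nat.even_spec; exists K; lia).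
  unfold mp_row; destruct (Nat.odd m);
    [replace (2 * S K)%nat with (S (S (2 * K))) by lia
    |replace (2 * S K - 1)%nat with (S (2 * K)) by lia]; field.
Qed.

Lemma mp_sum_points h g :
  sum1 (fun m => sum1 (fun k => g m (mp_row m k)) (S h)) (S (2 * h)) = mp_sum (2 * h + 2) g.
Proof.
  unfold mp_sum; replace (2 * h + 2 - 1)%nat with (S (2 * h)) by lia.
  replace (2 * h + 2)%nat with (2 * S h)%nat by lia.
  apply sum1_ext; intros m _; apply (sum1_mp_row m (g m)).
Qed.

Lemma mp_sum_ext N f g :
  (forall m l, f m l = g m l) -> mp_sum N f = mp_sum N g.
Proof. intros H; apply sum1_ext; intros; apply sum1_ext; intros; rewrite H; reflexivity. Qed.

Lemma mp_sum_plus N f g : mp_sum N (fun m l => f m l + g m l) = mp_sum N f + mp_sum N g.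
Proof.
  unfold mp_sum; rewrite <- sum1_plus; apply sum1_ext; intros m _.
  rewrite <- sum1_plus; apply sum1_ext; intros; ring.
Qed.

Lemma mp_sum_scal N c g : mp_sum N (fun m l => c * g m l) = c * mp_sum N g.
Proof.
  unfold mp_sum; rewrite <- sum1_scal; apply sum1_ext; intros m _.
  rewrite <- sum1_scal; apply sum1_ext; intros; ring.
Qed.

Lemma mp_sum_sum1 N (g : nat -> nat -> nat -> R) K :
  mp_sum N (fun m l => sum1 (fun i => g i m l) K) = sum1 (fun i => mp_sum N (g i)) K.
Proof.
  induction K as [|K IH]; cbn [sum1]; [|rewrite mp_sum_plus, IH; reflexivity].
  rewrite (mp_sum_ext N _ (fun m l => 0 * 0)) by (intros; ring).
  rewrite mp_sum_scal; ring.
Qed.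

Lemma mp_sum_le_grid N (f : R -> R -> R) : (forall a b, 0 <= f a b) ->
  mp_sum N (fun m l => f (node N m) (node (S N) l)) <= grid N f.
Proof.
  intros Hf; apply sum1_le; intros m _; apply sum1_le; intros l _.
  specialize (Hf (node N m) (node (S N) l)).
  rewrite !pow_neg1_odd; destruct (Nat.odd m), (Nat.odd l); lra.
Qed.

(* On the half grid two products of sines also alias when the frequencies add up to
   [(N, N + 1)], which the degree bound rules out. *)
Lemma mp_sum_orthogonal N p q p' q' :
  (1 <= p)%nat -> (1 <= q)%nat -> (1 <= p')%nat -> (1 <= q')%nat ->
  (p + q <= N)%nat -> (p' + q' <= N)%nat ->
  mp_sum N (fun m l => sin (INR p' * node N m) * sin (INR p * node N m) *
                       (sin (INR q' * node (S N) l) * sin (INR q * node (S N) l))) =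
  if andb (Nat.eqb p' p) (Nat.eqb q' q) then INR N * INR (S N) / 8 else 0.
Proof.
  intros Hp Hq Hp' Hq' H H'. destruct N as [|M]; [lia|].
  unfold mp_sum; replace (S M - 1)%nat with M by lia.
  set (s := fun m => sin (INR p' * node (S M) m) * sin (INR p * node (S M) m)).
  set (t := fun l => sin (INR q' * node (S (S M)) l) * sin (INR q * node (S (S M)) l)).
  (* The half-grid sum is half of the product of the plain sums minus half of the product of the
     alternating ones. *)
  rewrite (sum1_ext _ (fun m => (sum1 t (S M) / 2) * s m
       + (- (sum1 (fun l => (-1) ^ l * t l) (S M) / 2)) * ((-1) ^ m * s m))).
  2: { intros m _.
       rewrite (sum1_ext _ (fun l => (s m / 2) * t l
            + (- ((-1) ^ m * s m / 2)) * ((-1) ^ l * t l)))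
         by (intros l _; unfold s, t; field).
       rewrite sum1_plus, !sum1_scal; field. }
  rewrite sum1_plus, !sum1_scal; unfold s, t.
  rewrite !sin_node_orthogonal, !sin_node_alternating by lia.
  (* Both alternating sums are nonzero only if the four indices add up to 2N + 1, but they add up to
     at most 2N. *)
  destruct (Nat.eqb_spec p' p), (Nat.eqb_spec q' q), (Nat.eqb_spec (p' + p) (S M)),
    (Nat.eqb_spec (q' + q) (S (S M))); try lia; cbn [andb]; field.
Qed.

(** * Reproduction of polynomials from their values on the half grid *)

Definition reproduced (N : nat) (f : R -> R -> R) : Prop :=
  forall x y, f x y = 8 / (INR N * INR (S N)) *
    mp_sum N (fun m l => sin (node N m) * sin (node (S N) l)
                         * sinker N x y (node N m) (node (S N) l)
                         * f (cos (node N m)) (cos (node (S N) l))).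

Lemma reproduced_ext N f g : (forall x y, f x y = g x y) -> reproduced N f -> reproduced N g.
Proof.
  intros H Hf x y; rewrite <- H, Hf; f_equal.
  apply mp_sum_ext; intros; rewrite H; reflexivity.
Qed.

Lemma reproduced_plus N f g :
  reproduced N f -> reproduced N g -> reproduced N (fun x y => f x y + g x y).
Proof.
  intros Hf Hg x y; rewrite Hf, Hg, <- Rmult_plus_distr_l, <- mp_sum_plus; f_equal.
  apply mp_sum_ext; intros; ring.
Qed.

Lemma reproduced_scal N c f : reproduced N f -> reproduced N (fun x y => c * f x y).
Proof.
  intros Hf x y; rewrite Hf, <- Rmult_assoc, (Rmult_comm c), Rmult_assoc, <- mp_sum_scal; f_equal.
  apply mp_sum_ext; intros; ring.
Qed.

Lemma reproduced_zero N : reproduced N (fun _ _ => 0).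
Proof.
  intros x y; rewrite (mp_sum_ext N _ (fun m l => 0 * 0)) by (intros; ring).
  rewrite mp_sum_scal; ring.
Qed.

Lemma reproduced_sum_f_R0 N (F : nat -> R -> R -> R) K :
  (forall i, (i <= K)%nat -> reproduced N (F i)) ->
  reproduced N (fun x y => sum_f_R0 (fun i => F i x y) K).
Proof.
  induction K as [|K IH]; intros H; simpl; [apply H; lia|].
  apply reproduced_plus; [apply IH; intros; apply H; lia | apply H; lia].
Qed.

(** The sine factors turn the values of [chebU] at the nodes into sin (p a) and sin (q b), so
    orthogonality selects one term of the kernel; 8 / (N (N + 1)) normalises it. *)
Lemma reproduced_chebU N p q : (1 <= p)%nat -> (1 <= q)%nat -> (p + q <= N)%nat ->
  reproduced N (fun x y => chebU x p * chebU y q).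
Proof.
  intros Hp Hq H x y.
  assert (0 < INR N) by (apply lt_0_INR; lia).
  assert (0 < INR (S N)) by (apply lt_0_INR; lia).
  rewrite (mp_sum_ext N _ (fun m l => sum1 (fun q' => sum1 (fun p' =>
    chebU y q' * chebU x p' *
    (sin (INR p' * node N m) * sin (INR p * node N m) *
     (sin (INR q' * node (S N) l) * sin (INR q * node (S N) l)))) (N - q')) N)).
  2: { intros m l; rewrite <- (chebU_cos (node N m) p), <- (chebU_cos (node (S N) l) q).
       set (a := node N m); set (b := node (S N) l).
       replace (sin a * sin b * sinker N x y a b * (chebU (cos a) p * chebU (cos b) q)) with
         (chebU (cos a) p * sin a * (chebU (cos b) q * sin b) * sinker N x y a b) by ring.
       unfold sinker; rewrite <- sum1_scal; apply sum1_ext; intros q' _.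
       rewrite <- !sum1_scal; apply sum1_ext; intros; ring. }
  rewrite mp_sum_sum1.
  rewrite (sum1_ext _ (fun q' => if Nat.eqb q' q
             then INR N * INR (S N) / 8 * (chebU x p * chebU y q') else 0)).
  - rewrite sum1_delta, (proj2 (Nat.leb_le 1 q)), (proj2 (Nat.leb_le q N)) by lia.
    cbn [andb]; field; lra.
  - intros q' Hq'; rewrite mp_sum_sum1.
    rewrite (sum1_ext _ (fun p' => if Nat.eqb p' p then
       (if Nat.eqb q' q then INR N * INR (S N) / 8 * (chebU x p' * chebU y q') else 0) else 0)).
    + rewrite sum1_delta, (proj2 (Nat.leb_le 1 p)) by lia; cbn [andb].
      destruct (Nat.eqb_spec q' q) as [->|]; [|destruct (Nat.leb p (N - q')); reflexivity].
      rewrite (proj2 (Nat.leb_le p (N - q))) by lia; reflexivity.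
    + intros p' Hp'; rewrite mp_sum_scal, mp_sum_orthogonal by lia.
      destruct (Nat.eqb p' p), (Nat.eqb q' q); cbn [andb]; ring.
Qed.

(** By 2 x U_(p-1) = U_p + U_(p-2), a factor x or y is traded for a unit shift of an index.
    Generality in p and q makes the induction run; the total k + r + p + q never grows. *)
Lemma reproduced_monomial_chebU N k r p q : (k + r + p + q <= N)%nat ->
  reproduced N (fun x y => x ^ k * y ^ r * (chebU x p * chebU y q)).
Proof.
  revert r p q; induction k as [|k IHk].
  - induction r as [|r IHr]; intros p q H.
    + apply reproduced_ext with (fun x y => chebU x p * chebU y q); [intros; simpl; ring|].
      destruct p as [|p], q as [|q];
        try (apply reproduced_ext with (fun _ _ => 0);
             [intros; simpl (chebU _ 0); ring | apply reproduced_zero]).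
      apply reproduced_chebU; lia.
    + destruct q as [|q].
      * apply reproduced_ext with (fun _ _ => 0); [intros; simpl (chebU _ 0); ring|].
        apply reproduced_zero.
      * apply reproduced_ext with (fun x y =>
          / 2 * (x ^ 0 * y ^ r * (chebU x p * chebU y (S (S q)))
                 + x ^ 0 * y ^ r * (chebU x p * chebU y q))).
        { intros; rewrite chebU_rec, <- tech_pow_Rmult; field. }
        apply reproduced_scal, reproduced_plus; apply IHr; lia.
  - intros r p q H; destruct p as [|p].
    + apply reproduced_ext with (fun _ _ => 0); [intros; simpl (chebU _ 0); ring|].
      apply reproduced_zero.
    + apply reproduced_ext with (fun x y =>
        / 2 * (x ^ k * y ^ r * (chebU x (S (S p)) * chebU y q)
               + x ^ k * y ^ r * (chebU x p * chebU y q))).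
      { intros; rewrite chebU_rec, <- tech_pow_Rmult; field. }
      apply reproduced_scal, reproduced_plus; apply IHk; lia.
Qed.

(** A monomial is taken with p = q = 1, where [chebU] is 1; these two units account for n + 2. *)
Lemma reproduced_P2 n f : in_P2 n f -> reproduced (n + 2) f.
Proof.
  intros [c Hc].
  apply reproduced_ext with (fun x y =>
    sum_f_R0 (fun i => sum_f_R0 (fun j =>
      c i j * (x ^ i * y ^ j * (chebU x 1 * chebU y 1))) (n - i)) n).
  { intros x y; rewrite Hc; apply sum_eq; intros i _; apply sum_eq; intros j _; simpl; ring. }
  apply (reproduced_sum_f_R0 _ (fun i x y => sum_f_R0 (fun j =>
      c i j * (x ^ i * y ^ j * (chebU x 1 * chebU y 1))) (n - i))); intros i Hi.
  apply (reproduced_sum_f_R0 _ (fun j x y =>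
      c i j * (x ^ i * y ^ j * (chebU x 1 * chebU y 1)))); intros j Hj.
  apply reproduced_scal, reproduced_monomial_chebU; lia.
Qed.

Lemma mp_y_node n m k : (1 <= k)%nat -> mp_y n m k = cos (node (S (n + 2)) (mp_row m k)).
Proof.
  intros Hk; unfold mp_y, mp_row, node; replace (n + 3)%nat with (S (n + 2)) by lia.
  destruct (Nat.odd m); [rewrite mult_INR | rewrite minus_INR, mult_INR by lia]; reflexivity.
Qed.

(** The basis polynomial is reproduced from its own values on the half grid, which are Kronecker
    deltas, so a single kernel term survives. *)
Lemma mp_lagrange_eq h l m k x y :
  is_MP_lagrange_basis (2 * h) l -> mp_index (2 * h) m k ->
  let N := (2 * h + 2)%nat in
  l m k x y = 8 / (INR N * INR (S N)) *
    (sin (node N m) * sin (node (S N) (mp_row m k))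
     * sinker N x y (node N m) (node (S N) (mp_row m k))).
Proof.
  intros [Hdeg Hval] Hmk N.
  rewrite (reproduced_P2 _ _ (Hdeg m k Hmk) x y); fold N; f_equal; unfold N at 1.
  rewrite <- (mp_sum_points h (fun m' l' => sin (node N m') * sin (node (S N) l') *
     sinker N x y (node N m') (node (S N) l') * l m k (cos (node N m')) (cos (node (S N) l')))).
  destruct Hmk as [Hm Hk].
  assert (Eh : Nat.div (2 * h) 2 = h) by (rewrite Nat.mul_comm; apply Nat.div_mul; lia).
  set (w := fun m' k' => sin (node N m') * sin (node (S N) (mp_row m' k'))
     * sinker N x y (node N m') (node (S N) (mp_row m' k'))).
  rewrite (sum1_ext _ (fun m' => if Nat.eqb m' m then w m' k else 0)).
  - rewrite sum1_delta, (proj2 (Nat.leb_le 1 m)), (proj2 (Nat.leb_le m (S (2 * h)))) by lia.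
    reflexivity.
  - intros m' Hm'.
    rewrite (sum1_ext _ (fun k' => if Nat.eqb k' k then
                           (if Nat.eqb m' m then w m' k' else 0) else 0)).
    + rewrite sum1_delta, (proj2 (Nat.leb_le 1 k)), (proj2 (Nat.leb_le k (S h))) by lia.
      reflexivity.
    + intros k' Hk'.
      assert (V : l m k (cos (node N m')) (cos (node (S N) (mp_row m' k'))) =
                  if (Nat.eqb m m' && Nat.eqb k k')%bool then 1 else 0).
      { unfold N; rewrite <- mp_y_node by lia; apply Hval; split; lia. }
      rewrite V, (Nat.eqb_sym m), (Nat.eqb_sym k).
      fold (w m' k'). destruct (Nat.eqb m' m), (Nat.eqb k' k); cbn [andb]; ring.
Qed.

Theorem theorem12 :
  exists C : R, 0 < C /\
    forall n : nat, (0 < n)%nat -> Nat.even n = true ->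
    forall l : nat -> nat -> R -> R -> R, is_MP_lagrange_basis n l ->
    forall x y : R, -1 <= x <= 1 -> -1 <= y <= 1 ->
      MP_lebesgue_function n l x y <= C * INR n ^ 2.
Proof.
  (* 11040 = 8 * 345 * 4: the kernel normalisation, the grid bound, and N^2 <= 4 n^2 because n >=
     2. *)
  exists 11040; split; [lra|]. intros n Hn Hev l Hl x y Hx Hy.
  apply Nat.even_spec in Hev; destruct Hev as [h ->].
  assert (Eh : Nat.div (2 * h) 2 = h) by (rewrite Nat.mul_comm; apply Nat.div_mul; lia).
  unfold MP_lebesgue_function; rewrite Eh.
  set (N := (2 * h + 2)%nat).
  assert (HN : 0 < INR N) by (apply lt_0_INR; lia).
  assert (HNn : INR N <= 2 * INR (2 * h)).
  { change 2 with (INR 2) at 1; rewrite <- mult_INR; apply le_INR; lia. }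
  set (K := fun a b => Rabs (sin a * sin b * sinker N x y a b)).
  rewrite (sum_f_R0_sum1 (fun m => sum_f_R0 (fun j => Rabs (l m (S j) x y)) h)).
  rewrite (sum1_ext _ (fun m => 8 / (INR N * INR (S N)) *
             sum1 (fun k => K (node N m) (node (S N) (mp_row m k))) (S h))).
  2: { intros m Hm. rewrite (sum_f_R0_sum1 (fun k => Rabs (l m k x y))).
       rewrite <- sum1_scal; apply sum1_ext; intros k Hk.
       rewrite (mp_lagrange_eq h l m k x y Hl) by (split; lia).
       fold N; rewrite Rabs_mult, (Rabs_pos_eq (8 / _)); [reflexivity|].
       rewrite S_INR; apply Rmult_le_pos; [lra | apply Rlt_le, Rinv_0_lt_compat; nra]. }
  rewrite sum1_scal, (mp_sum_points h (fun m j => K (node N m) (node (S N) j))); fold N.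
  assert (HK : mp_sum N (fun m j => K (node N m) (node (S N) j)) <= 345 * INR N ^ 4).
  { eapply Rle_trans; [apply mp_sum_le_grid; intros; apply Rabs_pos|].
    apply grid_lebesgue; auto; lia. }
  apply Rle_trans with (8 / INR N ^ 2 * (345 * INR N ^ 4)).
  - apply Rmult_le_compat.
    + rewrite S_INR; apply Rmult_le_pos; [lra | apply Rlt_le, Rinv_0_lt_compat; nra].
    + unfold mp_sum; apply sum1_ge0; intros m _; apply sum1_ge0; intros j _.
      pose proof (Rabs_pos (sin (node N m) * sin (node (S N) j)
                            * sinker N x y (node N m) (node (S N) j))) as HKp.
      unfold K. rewrite !pow_neg1_odd; destruct (Nat.odd m), (Nat.odd j); lra.
    + apply Rmult_le_compat_l; [lra|]; apply Rinv_le_contravar; [nra|].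
      rewrite S_INR; nra.
    + exact HK.
  - replace (8 / INR N ^ 2 * (345 * INR N ^ 4)) with (2760 * INR N ^ 2) by (field; lra).
    nra.
Qed.
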